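(* Let $q$ be a prime power and let $n\ge 2$ be an integer. Then \[ s_q(n,2)=(n-1)q^2(q-1)+\binom{n}{2}(q-1)^2. \]
   Context: $\mathbb{F}_q$ is the finite field with $q$ elements. $\mathrm{U}(n,\mathbb{F}_q)$ is the $\mathbb{F}_q$-vector space of $n\times n$ upper triangular matrices over $\mathbb{F}_q$ (entries $m_{i,j}=0$ whenever $i>j$). For $M\in \mathrm{U}(n,\mathbb{F}_q)$ and $1\le i\le n$, $M_{[i]}$ is the $i\times(n-i+1)$ submatrix of $M$ obtained by deleting the first $i-1$ columns and the last $n-i$ rows (i.e. rows $1,\dots,i$ and columns $i,\dots,n$). The flag-rank weight of $M$ is $\mathrm{fr}(M)=\sum_{i=1}^{n}\mathrm{rk}(M_{[i]})$. The number $s_q(n,t)$ is the size of the flag-rank sphere of radius $t$: $s_q(n,t)=|\{A\in \mathrm{U}(n,\mathbb{F}_q):\mathrm{fr}(A)=t\}|$. *)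

(* Defs.v *)
From mathcomp Require Import all_boot all_order all_algebra.
Set Implicit Arguments.
Unset Strict Implicit.
Unset Printing Implicit Defensive.
Import GRing.Theory.
Local Open Scope ring_scope.

Definition upper_triangular (F : finFieldType) (n : nat) : {set 'M[F]_n} :=
  [set M : 'M[F]_n | [forall i : 'I_n, forall j : 'I_n, (j < i)%N ==> (M i j == 0)]].

(* Indices are 0-based: for i : 'I_n the block consists of rows 0, ..., i and
   columns i, ..., n - 1; the textbook M_[k], 1 <= k <= n, is the case
   i = k - 1. *)
Definition flag_row (n : nat) (i : 'I_n) : 'I_i.+1 -> 'I_n :=
  widen_ord (ltn_ord i).

Definition flag_col (n : nat) (i : 'I_n) (j : 'I_(n - i)) : 'I_n :=
  cast_ord (subnKC (ltnW (ltn_ord i))) (rshift i j).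

Definition flag_block (F : finFieldType) (n : nat) (M : 'M[F]_n) (i : 'I_n) :
    'M[F]_(i.+1, n - i) :=
  mxsub (@flag_row n i) (@flag_col n i) M.

Definition flag_rank (F : finFieldType) (n : nat) (M : 'M[F]_n) : nat :=
  (\sum_(i < n) \rank (flag_block M i))%N.

Definition sphere_size (F : finFieldType) (n t : nat) : nat :=
  #|[set A in upper_triangular F n | flag_rank A == t]|.

(* Main.v *)
(** A nonzero entry in position (p, r) of an upper triangular matrix makes every
    block k with p <= k <= r nonzero.  Hence in a matrix of flag-rank 2 exactly
    two blocks i < j are nonzero (a single nonzero block forces a multiple of
    E_ii, of flag-rank at most 1), and the matrix is a E_ii + b E_ij + c E_jj,
    where b <> 0 is possible only if j = i + 1.  For j = i + 1 and b <> 0 the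
    scalars a and c are arbitrary; for b = 0 both must be nonzero. *)
Require Import Defs.
From mathcomp Require Import all_boot all_order all_algebra.
From mathcomp Require Import zify.
Set Implicit Arguments.
Unset Strict Implicit.
Unset Printing Implicit Defensive.
Import GRing.Theory.
Local Open Scope ring_scope.

(** Such a matrix is a column times its row [k], so it factors through dimension 1. *)
Lemma mxrank_single_row (F : fieldType) (m n : nat) (B : 'M[F]_(m, n)) (k : 'I_m) :
  (forall p r, p != k -> B p r = 0) -> (\rank B <= 1)%N.
Proof.
move=> B0; have -> : B = delta_mx k 0 *m row k B.
  apply/matrixP=> p r; rewrite mxE big_ord1 !mxE eqxx andbT.
  by case: eqVneq => [->|/B0->]; rewrite ?mul1r ?mul0r.
exact: leq_trans (mxrankM_maxr _ _) (rank_leq_row _).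
Qed.

Lemma mxrank_single_col (F : fieldType) (m n : nat) (B : 'M[F]_(m, n)) (k : 'I_n) :
  (forall p r, r != k -> B p r = 0) -> (\rank B <= 1)%N.
Proof.
move=> B0; rewrite -mxrank_tr; apply: (@mxrank_single_row _ _ _ _ k) => p r pk.
by rewrite mxE B0.
Qed.

Section FlagBlock.
Variables (F : finFieldType) (n : nat).
Implicit Types (A : 'M[F]_n) (i j k p r : 'I_n).

(** Moves to the indices of [A], where entry (p, r) sits at (p, r - k) in the block, so that later
    arguments avoid the ordinals of the block. *)
Lemma flag_block_eq0P A k :
  reflect (forall p r, (p <= k <= r)%N -> A p r = 0) (flag_block A k == 0).
Proof.
apply: (iffP eqP) => [B0 p r /andP[pk kr] | A0].
  have rk : (r - k < n - k)%N by move: (ltn_ord r); lia.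
  have := congr1 (fun B : 'M_(_, _) => B (Ordinal (pk : p < k.+1)%N) (Ordinal rk)) B0.
  rewrite !mxE => <-; congr (A _ _); apply: val_inj => //=.
  by rewrite subnKC.
apply/matrixP=> p r; rewrite !mxE A0 //=.
by rewrite -ltnS ltn_ord leq_addr.
Qed.

Lemma flag_block_neq0 A k p r :
  (p <= k <= r)%N -> A p r != 0 -> flag_block A k != 0.
Proof. by move=> pkr; apply: contraNN => /flag_block_eq0P ->. Qed.

(** Only the last row of the block, which comes from row [k] of [A], can be nonzero. *)
Lemma rank_flag_block_row A k :
  (forall p r, (p < k)%N -> (k <= r)%N -> A p r = 0) ->
  (\rank (flag_block A k) <= 1)%N.
Proof.
move=> A0; apply: (@mxrank_single_row _ _ _ _ ord_max) => p r.
rewrite -val_eqE /= => pk; rewrite mxE; apply: A0 => /=; last exact: leq_addr.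
by rewrite ltn_neqAle pk -ltnS ltn_ord.
Qed.

(** Only the first column of the block, which comes from column [k] of [A], can be nonzero. *)
Lemma rank_flag_block_col A k :
  (forall p r, (p <= k)%N -> (k < r)%N -> A p r = 0) ->
  (\rank (flag_block A k) <= 1)%N.
Proof.
have k0 : (0 < n - k)%N by rewrite subn_gt0.
move=> A0; apply: (@mxrank_single_col _ _ _ _ (Ordinal k0)) => p r.
rewrite -val_eqE /= => rk; rewrite mxE; apply: A0 => /=.
  by rewrite -ltnS ltn_ord.
by move: rk; lia.
Qed.

Lemma upper_triangularP A :
  reflect (forall i j, (j < i)%N -> A i j = 0) (A \in upper_triangular F n).
Proof.
rewrite inE; apply: (iffP idP) => [/forallP Au i j ji | Au].
  by have /forallP /(_ j) := Au i; rewrite ji => /eqP.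
by apply/forallP=> i; apply/forallP=> j; apply/implyP=> /Au ->.
Qed.

Definition corner_mx (x : ('I_n * 'I_n) * (F * F * F)) : 'M[F]_n :=
  let: ((i, j), (a, b, c)) := x in
  a *: delta_mx i i + b *: delta_mx i j + c *: delta_mx j j.

Lemma corner_mxE i j a b c p r :
  corner_mx ((i, j), (a, b, c)) p r =
    a *+ ((p == i) && (r == i)) + b *+ ((p == i) && (r == j))
    + c *+ ((p == j) && (r == j)).
Proof. by rewrite !mxE !mulr_natr. Qed.

(** The two pieces, b = 0 and b <> 0, give the two terms of the formula; the condition on b makes
    them disjoint. *)
Definition corner_params : {set ('I_n * 'I_n) * (F * F * F)} :=
  setX [set ij : 'I_n * 'I_n | (ij.1 < ij.2)%N]
       (setX (setX [set~ 0] [set 0]) [set~ 0])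
  :|: setX [set ij : 'I_n * 'I_n | ij.2 == ij.1.+1 :> nat]
       (setX (setX setT [set~ 0]) setT).

Lemma mem_corner_params i j a b c :
  (((i, j), (a, b, c)) \in corner_params) =
  (i < j)%N && (if b == 0 then (a != 0) && (c != 0) else j == i.+1 :> nat).
Proof.
rewrite !inE /= andbT; case: (eqVneq b 0) => [_|bn0] /=; rewrite ?andbF ?orbF ?andbT //=.
by case: (j =P i.+1 :> nat) => [->|_]; rewrite ?ltnSn ?andbF.
Qed.

(** Entry (i, i) lies in block i only, (j, j) in block j only, and (i, j) in blocks i to j, which
    are just i and j when b <> 0. Hence the matrix determines the pair (i, j). *)
Lemma corner_flag_block_neq0 i j a b c k :
  ((i, j), (a, b, c)) \in corner_params ->
  (flag_block (corner_mx ((i, j), (a, b, c))) k != 0) = (k == i) || (k == j).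
Proof.
rewrite mem_corner_params => /andP[ij Hb].
have nji : (j == i) = false by apply/eqP=> e; move: ij; rewrite e ltnn.
have nij : (i == j) = false by rewrite eq_sym.
apply/idP/idP => [|Hk].
  apply: contraNT; rewrite negb_or => /andP[ki kj].
  apply/flag_block_eq0P => p r pkr; rewrite corner_mxE.
  have -> : (p == i) && (r == i) = false.
    by apply/negP=> /andP[/eqP e1 /eqP e2]; move: ki pkr; rewrite -val_eqE /= e1 e2; lia.
  have -> : (p == j) && (r == j) = false.
    by apply/negP=> /andP[/eqP e1 /eqP e2]; move: kj pkr; rewrite -val_eqE /= e1 e2; lia.
  rewrite !mulr0n add0r addr0; case: (eqVneq b 0) Hb => [->|_ /eqP Hj]; first by rewrite mul0rn.
  case: andP => // -[/eqP e1 /eqP e2]; move: ki kj pkr.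
  by rewrite -!val_eqE /= e1 e2; lia.
(* If b = 0, the diagonal entry (k, k) is a nonzero witness; otherwise b itself lies in both
   blocks. *)
case: (eqVneq b 0) Hb => [b0 /andP[a0 c0]|b0 _].
  apply: (@flag_block_neq0 _ k k k); first by rewrite leqnn.
  by rewrite corner_mxE b0; case/orP: Hk => /eqP->;
     rewrite ?eqxx ?nij ?nji ?mul0rn ?mulr0n ?mulr1n ?add0r ?addr0.
apply: (@flag_block_neq0 _ k i j).
  by case/orP: Hk => /eqP->; rewrite leqnn ltnW.
by rewrite corner_mxE !eqxx nij nji /= !mulr0n mulr1n add0r addr0.
Qed.

Lemma corner_mx_inj : {in corner_params &, injective corner_mx}.
Proof.
move=> [[i j] [[a b] c]] [[i' j'] [[a' b'] c']] Hx Hy e.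
have E k : (k == i) || (k == j) = (k == i') || (k == j').
  by rewrite -(corner_flag_block_neq0 k Hx) e (corner_flag_block_neq0 k Hy).
move: Hx Hy; rewrite !mem_corner_params => /andP[ij _] /andP[ij' _].
(* The unordered pairs agree by [E], and both are increasing. *)
have [ei ej] : i = i' /\ j = j'.
  move: (E i) (E j) (E i') (E j'); rewrite !eqxx ?orbT /= -!val_eqE /=.
  by move=> *; split; apply: val_inj => /=; lia.
subst i' j'.
have nji : (j == i) = false by apply/eqP=> eji; move: ij; rewrite eji ltnn.
have nij : (i == j) = false by rewrite eq_sym.
have ev p r := congr1 (fun B : 'M_n => B p r) e.
move: (ev i i) (ev i j) (ev j j); rewrite !corner_mxE !eqxx nij nji /=.
by rewrite !mulr0n !mulr1n !add0r !addr0 => -> -> ->.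
Qed.

(** Blocks i and j are nonzero, but block i lives in its last row and block j in its first column,
    so each has rank 1; all others vanish. *)
Lemma corner_mx_sphere x : x \in corner_params ->
  corner_mx x \in [set A in upper_triangular F n | flag_rank A == 2].
Proof.
case: x => [[i j] [[a b] c]] Hx; have Hk k := corner_flag_block_neq0 k Hx.
move: Hx; rewrite mem_corner_params => /andP[ij _].
set A := corner_mx _ in Hk *.
have A0 p r : [|| (p != i) && (p != j), (r != i) && (r != j) | (p == j) && (r == i)] ->
    A p r = 0.
  rewrite corner_mxE; case: (eqVneq p i) => [->|_] /=;
  case: (eqVneq r j) => [->|_] /=; rewrite ?mulr0n ?addr0 ?add0r //; move: ij;
  rewrite ?eqxx ?orbF ?andbF ?andbT //= ?orbF -?val_eqE /=;
  case: eqP => //; case: eqP => //; rewrite ?mulr0n ?add0r //; lia.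
rewrite inE; apply/andP; split.
  apply/upper_triangularP => p r rp; apply: A0; rewrite -!val_eqE /=; lia.
have nij : i != j by rewrite -val_eqE /=; lia.
have rk0 k : (k != i) && (k != j) -> \rank (flag_block A k) = 0%N.
  by rewrite -negb_or -Hk negbK => /eqP->; rewrite mxrank0.
have rki : \rank (flag_block A i) = 1%N.
  apply/eqP; rewrite eqn_leq lt0n mxrank_eq0 Hk eqxx andbT.
  by apply: rank_flag_block_row => p r *; apply: A0; rewrite -!val_eqE /=; lia.
have rkj : \rank (flag_block A j) = 1%N.
  apply/eqP; rewrite eqn_leq lt0n mxrank_eq0 Hk eqxx orbT andbT.
  by apply: rank_flag_block_col => p r *; apply: A0; rewrite -!val_eqE /=; lia.
rewrite /flag_rank (bigD1 i) //= (bigD1 j) 1?eq_sym //= rki rkj.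
by rewrite big1 // => k /rk0.
Qed.

Lemma sphere_corner_mx A :
  A \in upper_triangular F n -> flag_rank A = 2%N ->
  exists2 x, x \in corner_params & A = corner_mx x.
Proof.
move=> /upper_triangularP Au fr2.
pose T := [set k | flag_block A k != 0].
have entryT p r k : A p r != 0 -> (p <= k <= r)%N -> k \in T.
  by move=> Apr pkr; rewrite inE; apply: flag_block_neq0 Apr.
have le_pr p r : A p r != 0 -> (p <= r)%N.
  by apply: contraNT; rewrite -ltnNge => /Au->.
have frT : flag_rank A = (\sum_(k in T) \rank (flag_block A k))%N.
  rewrite /flag_rank [RHS]big_mkcond /=; apply: eq_bigr => k _.
  by rewrite inE; case: eqP => [->|] //=; rewrite mxrank0.
(* Each nonzero block contributes at least 1 to the flag-rank. *)
have leT : (#|T| <= 2)%N.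
  rewrite -fr2 frT -sum1_card; apply: leq_sum => k.
  by rewrite inE -mxrank_eq0 lt0n.
have T0 : (0 < #|T|)%N.
  rewrite lt0n cards_eq0; apply/eqP=> T0.
  by move: fr2; rewrite frT T0 big_set0.
have T1 : #|T| != 1%N.
  apply/negP => /cards1P[i eT].
  suff: (flag_rank A <= 1)%N by rewrite fr2.
  (* A nonzero entry in row p makes block p nonzero, so p = i: block i has a single nonzero row. *)
  rewrite frT eT big_set1; apply: rank_flag_block_row => p r pi ir.
  apply/eqP; apply: contraTT pi => Apr; rewrite -leqNgt.
  by have := entryT p r p Apr; rewrite leqnn le_pr // eT inE => /(_ isT) /eqP->.
have /cards2P[i0 [j0 [ne eT0]]] : #|T| == 2%N
  by rewrite eqn_leq leT ltn_neqAle eq_sym T1 T0.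
have [i [j [ij eT]]] : exists i j, (i < j)%N /\ T = [set i; j].
  have [lt|] := ltnP i0 j0; first by exists i0, j0.
  move=> ge; exists j0, i0; split; last by rewrite setUC.
  by rewrite ltn_neqAle eq_sym ge andbT.
(* Blocks p and r are both nonzero, so p and r lie in {i, j}; triangularity rules out (j, i). *)
have supp p r : A p r != 0 ->
    [|| (p == i) && (r == i), (p == i) && (r == j) | (p == j) && (r == j)].
  move=> Apr; have pr := le_pr _ _ Apr.
  have := entryT p r p Apr; have := entryT p r r Apr.
  by rewrite eT !inE !leqnn pr -!val_eqE /= => /(_ isT) + /(_ isT); lia.
have nji : (j == i) = false by apply/eqP=> e; move: ij; rewrite e ltnn.
have nij : (i == j) = false by rewrite eq_sym.
exists ((i, j), (A i i, A i j, A j j)); last first.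
  apply/matrixP=> p r; rewrite corner_mxE.
  have [/eqP Apr|/supp] := boolP (A p r == 0); last first.
    by case/or3P=> /andP[/eqP-> /eqP->];
      rewrite !eqxx ?nij ?nji /= ?mulr0n ?mulr1n ?add0r ?addr0.
  have z (s t : 'I_n) : A s t *+ ((p == s) && (r == t)) = 0.
    by case: andP => //= -[/eqP<- /eqP<-]; rewrite Apr.
  by rewrite !z !addr0.
rewrite mem_corner_params ij /=; case: (eqVneq (A i j) 0) => [Aij|Aij].
  (* With A i j = 0, the diagonal entry is the only possible nonzero entry of block i, and likewise
     of block j. *)
  have iT : i \in T by rewrite eT !inE eqxx.
  have jT : j \in T by rewrite eT !inE eqxx orbT.
  apply/andP; split.
    move: iT; rewrite inE; apply: contraNN => /eqP Aii.
    apply/flag_block_eq0P => p r pir; apply/eqP; apply: contraT => Apr.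
    have := supp p r Apr; case/or3P=> /andP[/eqP e1 /eqP e2]; subst p r.
    - by rewrite Aii eqxx in Apr.
    - by rewrite Aij eqxx in Apr.
    - by move: pir ij; lia.
  move: jT; rewrite inE; apply: contraNN => /eqP Ajj.
  apply/flag_block_eq0P => p r pjr; apply/eqP; apply: contraT => Apr.
  have := supp p r Apr; case/or3P=> /andP[/eqP e1 /eqP e2]; subst p r.
  - by move: pjr ij; lia.
  - by rewrite Aij eqxx in Apr.
  - by rewrite Ajj eqxx in Apr.
(* Since A i j <> 0 and i < i + 1 <= j, block i + 1 is nonzero, which forces i + 1 = j. *)
have lt : (i.+1 < n)%N by move: (ltn_ord j); lia.
have := entryT i j (Ordinal lt) Aij; rewrite eT !inE -!val_eqE /=.
by rewrite leqnSn ij => /(_ isT); lia.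
Qed.

End FlagBlock.

Lemma card_ltn_pairs n : #|[set ij : 'I_n * 'I_n | (ij.1 < ij.2)%N]| = 'C(n, 2).
Proof.
rewrite -sum1_card (eq_bigl (fun ij : 'I_n * 'I_n => true && (ij.1 < ij.2)%N)); last first.
  by move=> ij; rewrite inE.
rewrite -(pair_big_dep xpredT (fun i j : 'I_n => i < j)%N (fun _ _ => 1%N)) /=.
(* With the larger index j outside, the inner count is j, and these sum to the binomial
   coefficient. *)
rewrite (exchange_big_dep xpredT) //= -bin2_sum big_mkord.
apply: eq_bigr => j _.
by rewrite -(big_ord_widen n (fun=> 1%N) (ltnW (ltn_ord j))) sum1_card card_ord.
Qed.

Lemma card_succ_pairs n :
  #|[set ij : 'I_n * 'I_n | ij.2 == ij.1.+1 :> nat]| = n.-1.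
Proof.
case: n => [|n] /=.
  by apply/eqP; rewrite cards_eq0; apply/eqP/setP => -[[]].
(* For size n + 1, the pairs are the image of i |-> (i, i + 1) on ['I_n]; [lift ord0] is the
   successor. *)
rewrite -[RHS]card_ord -(card_imset _ (_ : injective
  (fun i : 'I_n => (widen_ord (leqnSn n) i, lift ord0 i)))); last first.
  by move=> i j [/= e _]; apply: val_inj.
apply: eq_card => -[i j]; rewrite inE /=; apply/eqP/imsetP => [e|[k _ [-> ->]] //].
have lt : (i < n)%N by move: (ltn_ord j); lia.
by exists (Ordinal lt) => //; congr (_, _); apply: val_inj.
Qed.

Lemma card_corner_params (F : finFieldType) n :
  #|corner_params F n| =
  ((n - 1) * #|F| ^ 2 * (#|F| - 1) + 'C(n, 2) * (#|F| - 1) ^ 2)%N.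
Proof.
rewrite cardsU [_ :&: _](_ : _ = set0) ?cards0 ?subn0; last first.
  by apply/setP=> -[ij [[a b] c]]; rewrite !inE /=; case: (b == 0); rewrite /= ?andbF.
rewrite !cardsX card_ltn_pairs card_succ_pairs !cardsC1 !cards1 !cardsT.
by rewrite !subn1 muln1 mulnn mulnAC mulnn mulnA addnC.
Qed.

Theorem proposition3p2 (q : nat) (F : finFieldType) (hF : #|F| = q)
    (n : nat) (hn : (2 <= n)%N) :
  sphere_size F n 2 =
    ((n - 1) * q ^ 2 * (q - 1) + 'C(n, 2) * (q - 1) ^ 2)%N.
Proof.
(* The sphere is the image of [corner_params] under [corner_mx], which is injective there. *)
rewrite -hF -card_corner_params -(card_in_imset (@corner_mx_inj F n)).
apply: eq_card => A; apply/idP/imsetP => [|[x /corner_mx_sphere Hx ->] //].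
by rewrite inE => /andP[Au /eqP fr2]; apply: sphere_corner_mx.
Qed.
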